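(* Let $R$ be an admissible ring with ideal of definition $\mathfrak{a}$, and let $r\ge 1$. Then the topological ring $A=R\langle X_1,\ldots,X_r\rangle_\infty$ is admissible.
   Context: All rings are commutative. $p\ge 2$ is a fixed integer (not necessarily prime). A linearly topologized ring $A$ has an ideal of definition $J$ if $J$ is an open ideal and for every neighborhood $V$ of $0$ there is $n>0$ with $J^n\subset V$. $A$ is preadmissible if it has an ideal of definition, and admissible if moreover it is separated and complete. For a linearly topologized ring $R$ with fundamental system $(I_\lambda)$ of open ideals, $R[X_1^{1/p^\infty},\ldots,X_r^{1/p^\infty}]:=\bigcup_{i\ge 0}R[X_1^{1/p^i},\ldots,X_r^{1/p^i}]$ and $$R\langle X_1,\ldots,X_r\rangle_\infty:=\varprojlim_\lambda (R/I_\lambda)[X_1^{1/p^\infty},\ldots,X_r^{1/p^\infty}].$$ For $R$ admissible this is the ring of formal series $\sum_\alpha c_\alpha X^\alpha$, with $\alpha$ ranging over $(\mathbb{N}[1/p])^r$ ($\mathbb{N}[1/p]$ = non-negative elements of $\mathbb{Z}[1/p]$), $c_\alpha\in R$ and $\lim c_\alpha=0$ (every neighborhood of $0$ contains all but finitely many $c_\alpha$). Its topology has as fundamental system of neighborhoods of $0$ the sets $V'=\{\sum_\alpha c_\alpha X^\alpha : c_\alpha\in V\ \text{for all }\alpha\}$, with $V$ running over neighborhoods of $0$ in $R$. *)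

(* Defs.v *)
From HB Require Import structures.
From mathcomp Require Import all_boot all_order all_algebra.
From mathcomp Require Import all_classical topology tvs.
From mathcomp Require Import finmap monalg.

Set Implicit Arguments.
Unset Strict Implicit.
Unset Printing Implicit Defensive.

Import Order.TTheory GRing.Theory Num.Theory.

Local Open Scope fset_scope.
Local Open Scope classical_set_scope.
Local Open Scope ring_scope.
Local Open Scope quotient_scope.

(* The zero ring is allowed, hence [comPzRingType]. *)
HB.mixin Record hasContinuousMul R & TopologicalZmodule R & GRing.ComPzRing R := {
  mul_continuous : continuous (fun x : R * R => x.1 * x.2)
}.

#[short(type="topComRingType")]
HB.structure Definition TopologicalComRing :=
  {R of TopologicalZmodule R & GRing.ComPzRing R & hasContinuousMul R}.

Definition is_ideal (R : comPzRingType) (I : set R) : Prop :=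
  [/\ I 0, forall x y, I x -> I y -> I (x + y) & forall a x, I x -> I (a * x)].

Definition ideal_exp (R : comPzRingType) (J : set R) (n : nat) : set R :=
  smallest (@is_ideal R)
    [set x | exists u : 'I_n -> R, (forall i, J (u i)) /\ x = \prod_i u i].

Section Admissible.
Variable R : topComRingType.

Definition linearly_topologized : Prop :=
  forall V : set R, nbhs 0 V -> exists I, [/\ is_ideal I, open I & I `<=` V].

Definition ideal_of_definition (J : set R) : Prop :=
  [/\ is_ideal J, open J &
      forall V : set R, nbhs 0 V -> exists2 n, (0 < n)%N & ideal_exp J n `<=` V].

Definition cauchy_filter (F : set_system R) : Prop :=
  forall V : set R, nbhs 0 V -> \forall x & y \near F, V (x - y).

Definition complete : Prop :=
  forall F : set_system R, ProperFilter F -> cauchy_filter F ->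
  exists l : R, F --> l.

Definition preadmissible : Prop :=
  linearly_topologized /\ exists J, ideal_of_definition J.

Definition admissible : Prop :=
  [/\ preadmissible, hausdorff_space R & complete].

End Admissible.

Arguments linearly_topologized : clear implicits.
Arguments complete : clear implicits.
Arguments preadmissible : clear implicits.
Arguments admissible : clear implicits.

Record ideal (R : comPzRingType) :=
  Ideal { ideal_set :> set R; idealP : is_ideal ideal_set }.

(* MathComp's [{ideal_quot I}] requires the ideal to be proper; here the ring
   structure is put on the additive quotient for an arbitrary ideal. *)
Section QuotientRing.
Variables (R : comPzRingType) (I : ideal R).

Definition ideal_pred : {pred R} := fun x => x \in (I : set R).

Lemma ideal_predE x : (x \in ideal_pred) = ideal_set I x :> Prop.
Proof. exact: in_setE. Qed.

Lemma ideal_zmod_closed : zmod_closed ideal_pred.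
Proof.
have [I0 ID IM] := idealP I; split=> [|x y]; rewrite !ideal_predE //.
by move=> Ix Iy; apply: ID => //; rewrite -mulN1r; apply: IM.
Qed.

HB.instance Definition _ := GRing.isZmodClosed.Build R ideal_pred
  ideal_zmod_closed.

Definition quo := Quotient.quot ideal_pred.

HB.instance Definition _ := GRing.Zmodule.on quo.
HB.instance Definition _ := Quotient.on quo.

Definition toquo (x : R) : quo := \pi_quo x.

Lemma toquo_eq x y : toquo x = toquo y <-> ideal_set I (x - y).
Proof.
split=> [/eqP|Ixy]; last apply/eqP.
  by rewrite /toquo -Quotient.idealrBE ideal_predE.
by rewrite /toquo -Quotient.idealrBE ideal_predE.
Qed.

Lemma toquo_repr (x : quo) : toquo (repr x) = x.
Proof. exact: reprK. Qed.

Lemma toquoB : {morph toquo : x y / x - y}.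
Proof. exact: (raddfB (\pi_(Quotient.quot ideal_pred) : {additive _ -> _})). Qed.

HB.instance Definition _ := GRing.isZmodMorphism.Build R quo toquo toquoB.

Definition quo_one : quo := toquo 1.
Definition quo_mul (x y : quo) : quo := toquo (repr x * repr y).

Lemma toquo_mul x y : toquo (x * y) = quo_mul (toquo x) (toquo y).
Proof.
have [_ ID IM] := idealP I; rewrite /quo_mul; apply/toquo_eq.
have /toquo_eq Ix : toquo x = toquo (repr (toquo x)) by rewrite toquo_repr.
have /toquo_eq Iy : toquo y = toquo (repr (toquo y)) by rewrite toquo_repr.
move: (repr (toquo x)) (repr (toquo y)) Ix Iy => x' y' Ix Iy.
have -> : x * y - x' * y' = y * (x - x') + x' * (y - y').
  by rewrite !mulrBr [y * x]mulrC [y * x']mulrC addrA subrK.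
by apply: ID; apply: IM.
Qed.

Lemma quo_mulA : associative quo_mul.
Proof.
move=> x y z; rewrite -[x]toquo_repr -[y]toquo_repr -[z]toquo_repr.
by rewrite -!toquo_mul mulrA.
Qed.

Lemma quo_mulC : commutative quo_mul.
Proof.
by move=> x y; rewrite -[x]toquo_repr -[y]toquo_repr -!toquo_mul mulrC.
Qed.

Lemma quo_mul1r : left_id quo_one quo_mul.
Proof. by move=> x; rewrite -[x]toquo_repr -toquo_mul mul1r. Qed.

Lemma quo_mulDl : left_distributive quo_mul +%R.
Proof.
move=> x y z; rewrite -[x]toquo_repr -[y]toquo_repr -[z]toquo_repr.
by rewrite -raddfD -!toquo_mul -raddfD mulrDl.
Qed.

HB.instance Definition _ := GRing.Zmodule_isComPzRing.Build quo
  quo_mulA quo_mulC quo_mul1r quo_mulDl.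

Lemma toquo_monoid_morphism : monoid_morphism toquo.
Proof. by split=> // x y; apply: toquo_mul. Qed.

HB.instance Definition _ := GRing.isMonoidMorphism.Build R quo toquo
  toquo_monoid_morphism.

End QuotientRing.

Definition quo_map (R : comPzRingType) (I J : ideal R) (x : quo I) : quo J :=
  toquo J (repr x).

Lemma quo_mapE (R : comPzRingType) (I J : ideal R) (x : R) :
  I `<=` J -> quo_map J (toquo I x) = toquo J x.
Proof. by move=> IJ; apply/toquo_eq/IJ/toquo_eq; rewrite toquo_repr. Qed.

(* Same definitions as the ring structure that [monalg] puts on [{malg S[M]}],
   which is restricted there to nonzero rings [S]. *)
Section MonoidAlgebra.
Variables (M : nmodType) (S : comPzRingType).

Definition monoid_alg := {malg S[M]}.

HB.instance Definition _ := GRing.Zmodule.on monoid_alg.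

Implicit Types f g h : monoid_alg.

Definition malg_one : monoid_alg := << 1 *g (0 : M) >>.

Definition malg_mul f g : monoid_alg :=
  \sum_(a <- msupp f) \sum_(b <- msupp g) << f@_a * g@_b *g (a + b)%R >>.

Lemma malg_mulEw (d e : {fset M}) f g : (msupp f `<=` d)%fset ->
  (msupp g `<=` e)%fset ->
  malg_mul f g = \sum_(a <- d) \sum_(b <- e) << f@_a * g@_b *g (a + b)%R >>.
Proof.
move=> fd ge; rewrite /malg_mul (big_fset_incl _ fd) /=; last first.
  move=> a _ /mcoeff_outdom fa.
  by rewrite big1 // => b _; rewrite fa mul0r monalgU0.
apply: eq_bigr => a _; apply: big_fset_incl => // b _ /mcoeff_outdom ->.
by rewrite mulr0 monalgU0.
Qed.

Lemma malg_mulC : commutative malg_mul.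
Proof.
move=> f g; rewrite /malg_mul exchange_big /=.
by apply: eq_bigr => b _; apply: eq_bigr => a _; rewrite mulrC addrC.
Qed.

Lemma malg_mulDl : left_distributive malg_mul +%R.
Proof.
move=> f g h; rewrite (malg_mulEw (msuppD_le f g) (fsubset_refl _)).
rewrite (malg_mulEw (fsubsetUl (msupp f) (msupp g)) (fsubset_refl _)).
rewrite (malg_mulEw (fsubsetUr (msupp f) (msupp g)) (fsubset_refl _)).
rewrite -big_split /=; apply: eq_bigr => a _.
rewrite -big_split /=; apply: eq_bigr => b _.
by rewrite mcoeffD mulrDl monalgUD.
Qed.

Lemma malg_mulDr : right_distributive malg_mul +%R.
Proof. by move=> f g h; rewrite !(malg_mulC f) malg_mulDl. Qed.

Lemma malg_mul0r : left_zero 0 malg_mul.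
Proof. by move=> f; rewrite /malg_mul msupp0 big_seq_fset0. Qed.

Lemma malg_mulr0 : right_zero 0 malg_mul.
Proof. by move=> f; rewrite malg_mulC malg_mul0r. Qed.

Lemma malg_mulUg c a g :
  malg_mul << c *g a >> g = \sum_(b <- msupp g) << c * g@_b *g (a + b)%R >>.
Proof.
rewrite (malg_mulEw msuppU_le (fsubset_refl _)) big_seq_fset1.
by apply: eq_bigr => b _; rewrite mcoeffUU.
Qed.

Lemma malg_mulUU c d a b :
  malg_mul << c *g a >> << d *g b >> = << c * d *g (a + b)%R >>.
Proof. by rewrite (malg_mulEw msuppU_le msuppU_le) !big_seq_fset1 !mcoeffUU. Qed.

Lemma malg_mul1r : left_id malg_one malg_mul.
Proof.
move=> f; rewrite malg_mulUg [RHS]monalgE.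
by apply: eq_bigr => a _; rewrite mul1r add0r.
Qed.

Lemma malg_mul_suml (T : Type) (s : seq T) (F : T -> monoid_alg) g :
  malg_mul (\sum_(i <- s) F i) g = \sum_(i <- s) malg_mul (F i) g.
Proof.
exact: (big_morph (malg_mul^~ g) (fun _ _ => malg_mulDl _ _ _) (malg_mul0r _)).
Qed.

Lemma malg_mul_sumr (T : Type) (s : seq T) (F : T -> monoid_alg) g :
  malg_mul g (\sum_(i <- s) F i) = \sum_(i <- s) malg_mul g (F i).
Proof.
exact: (big_morph (malg_mul g) (fun _ _ => malg_mulDr _ _ _) (malg_mulr0 _)).
Qed.

Lemma malg_mulEl f g :
  malg_mul f g = \sum_(a <- msupp f) malg_mul << f@_a *g a >> g.
Proof. by rewrite {1}[f]monalgE malg_mul_suml. Qed.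

Lemma malg_mulEr f g :
  malg_mul f g = \sum_(b <- msupp g) malg_mul f << g@_b *g b >>.
Proof. by rewrite {1}[g]monalgE malg_mul_sumr. Qed.

Lemma malg_mulA : associative malg_mul.
Proof.
move=> f g h; rewrite malg_mulEl [malg_mul f g]malg_mulEl malg_mul_suml.
apply: eq_bigr => a _.
rewrite [malg_mul g h]malg_mulEl malg_mul_sumr.
rewrite [malg_mul _ g]malg_mulEr malg_mul_suml; apply: eq_bigr => b _.
rewrite [malg_mul _ h]malg_mulEr malg_mul_sumr [RHS]malg_mulEr.
by apply: eq_bigr => c _; rewrite !malg_mulUU mulrA addrA.
Qed.

HB.instance Definition _ := GRing.Zmodule_isComPzRing.Build monoid_alg
  malg_mulA malg_mulC malg_mul1r malg_mulDl.

End MonoidAlgebra.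

Lemma malg_mulE (M : nmodType) (S : comPzRingType) (f g : monoid_alg M S) :
  f * g = malg_mul f g.
Proof. by []. Qed.

Lemma mcoeff_map_mul (M : nmodType) (S T : comPzRingType) (phi : S -> T)
    (f g : monoid_alg M S) (f' g' : monoid_alg M T) :
  {morph phi : x y / x + y} -> phi 0 = 0 -> {morph phi : x y / x * y} ->
  (forall a, mcoeff a f' = phi (mcoeff a f)) ->
  (forall a, mcoeff a g' = phi (mcoeff a g)) ->
  forall a, mcoeff a (f' * g') = phi (mcoeff a (f * g)).
Proof.
move=> phiD phi0 phiM ff' gg' a.
have supp (h : monoid_alg M S) (h' : monoid_alg M T) :
    (forall a, mcoeff a h' = phi (mcoeff a h)) -> (msupp h' `<=` msupp h)%fset.
  move=> hh'; apply/fsubsetP => b; rewrite -!mcoeff_neq0.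
  by apply: contra_neq; rewrite hh' => ->.
rewrite !malg_mulE (malg_mulEw (supp _ _ ff') (supp _ _ gg')) /malg_mul.
rewrite !raddf_sum /= (big_morph _ phiD phi0); apply: eq_bigr => b _.
rewrite !raddf_sum /= (big_morph _ phiD phi0); apply: eq_bigr => c _.
by rewrite !mcoeffU ff' gg' -phiM; case: (_ == _); rewrite ?mulr0n.
Qed.

(* N[1/p], inside the rationals *)
Section Exponents.
Variable p : nat.

Definition Npinv_pred : {pred rat} :=
  fun x => (0 <= x) && `[< exists k : nat, p%:R ^+ k * x \is a Num.int >].

Lemma Npinv_predP x : reflect
  (0 <= x /\ exists k : nat, p%:R ^+ k * x \is a Num.int) (x \in Npinv_pred).
Proof. by apply: (iffP andP) => -[? /asboolP]. Qed.

Lemma Npinv_closed : GRing.addr_closed Npinv_pred.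
Proof.
split; first by apply/Npinv_predP; split=> //; exists 0%N; rewrite mulr0.
move=> x y /Npinv_predP[x0 [k kx]] /Npinv_predP[y0 [l ly]].
apply/Npinv_predP; split; first exact: addr_ge0.
have pX m : (p%:R ^+ m : rat) \is a Num.int by rewrite rpredX // rpred_nat.
exists (k + l)%N; rewrite exprD mulrDr [_ * x]mulrAC -[_ * y]mulrA.
apply: rpredD; apply: rpredM => //.
Qed.

Record Npinv := { Npinv_val : rat; _ : Npinv_pred Npinv_val }.

HB.instance Definition _ := [isSub for Npinv_val].
HB.instance Definition _ := [Choice of Npinv by <:].
HB.instance Definition _ :=
  GRing.SubChoice_isSubNmodule.Build rat Npinv_pred Npinv Npinv_closed.

End Exponents.

Definition expo (p r : nat) : nmodType := {ffun 'I_r -> Npinv p}.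

(* S[X_1^{1/p^oo}, ..., X_r^{1/p^oo}], the union over i of the polynomial rings
   S[X_1^{1/p^i}, ..., X_r^{1/p^i}]: finite sums of monomials with exponents in
   N[1/p]^r. *)
Definition perf_poly (p r : nat) (S : comPzRingType) : comPzRingType :=
  monoid_alg (expo p r) S.

Record open_ideal (R : topComRingType) := OpenIdeal {
  open_ideal_ideal :> ideal R;
  open_idealP : open (open_ideal_ideal : set R)
}.

Section OpenIdeals.
Variable R : topComRingType.

Lemma idealT_subproof : is_ideal [set: R]. Proof. by []. Qed.

Definition open_idealT : open_ideal R :=
  @OpenIdeal R (Ideal idealT_subproof) openT.

Lemma idealI_subproof (I J : ideal R) : is_ideal ((I : set R) `&` J).
Proof.
have [I0 ID IM] := idealP I; have [J0 JD JM] := idealP J; split=> //.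
- by move=> x y [Ix Jx] [Iy Jy]; split; [apply: ID | apply: JD].
- by move=> a x [Ix Jx]; split; [apply: IM | apply: JM].
Qed.

Definition open_idealI (I J : open_ideal R) : open_ideal R :=
  @OpenIdeal R (Ideal (idealI_subproof I J)) (openI (open_idealP I) (open_idealP J)).

End OpenIdeals.

(* R<X_1, ..., X_r>_oo, the inverse limit of the rings
   (R/I)[X_1^{1/p^oo}, ..., X_r^{1/p^oo}] over all the open ideals I of R *)
Record series (p r : nat) (R : topComRingType) := Series {
  proj :> forall I : open_ideal R, perf_poly p r (quo I);
  proj_compat : forall (I J : open_ideal R) (a : expo p r),
    (I : set R) `<=` J -> mcoeff a (proj J) = quo_map J (mcoeff a (proj I))
}.

Section SeriesRing.
Variables (p r : nat) (R : topComRingType).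
Local Notation A := (series p r R).

HB.instance Definition _ := gen_eqMixin A.
HB.instance Definition _ := gen_choiceMixin A.

Lemma seriesP (f g : A) : (forall I, f I = g I) -> f = g.
Proof.
case: f g => [f fP] [g gP] /= fg.
have E : f = g by exact: functional_extensionality_dep.
by subst g; congr Series; apply: Prop_irrelevance.
Qed.

Section QuoMap.
Variables (I J : open_ideal R).
Hypothesis IJ : (I : set R) `<=` J.

Lemma quo_mapB : {morph @quo_map R I J : x y / x - y}.
Proof.
move=> x y; rewrite -[x]toquo_repr -[y]toquo_repr -raddfB.
by rewrite !quo_mapE // raddfB.
Qed.

Lemma quo_map0 : quo_map J (0 : quo I) = 0.
Proof. by rewrite -(raddf0 (toquo I)) quo_mapE // raddf0. Qed.

Lemma quo_mapD : {morph @quo_map R I J : x y / x + y}.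
Proof.
move=> x y; rewrite -[x]toquo_repr -[y]toquo_repr -raddfD.
by rewrite !quo_mapE // raddfD.
Qed.

Lemma quo_mapM : {morph @quo_map R I J : x y / x * y}.
Proof.
move=> x y; rewrite -[x]toquo_repr -[y]toquo_repr -rmorphM.
by rewrite !quo_mapE // rmorphM.
Qed.

Lemma quo_map1 : quo_map J (1 : quo I) = 1.
Proof. by rewrite -(rmorph1 (toquo I)) quo_mapE // rmorph1. Qed.

End QuoMap.

Lemma series0_subproof (I J : open_ideal R) (a : expo p r) :
  (I : set R) `<=` J ->
  mcoeff a (0 : perf_poly p r (quo J)) =
  quo_map J (mcoeff a (0 : perf_poly p r (quo I))).
Proof. by move=> IJ; rewrite !mcoeff0 quo_map0. Qed.

Definition series0 : A := @Series p r R (fun=> 0) series0_subproof.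

Lemma series1_subproof (I J : open_ideal R) (a : expo p r) :
  (I : set R) `<=` J ->
  mcoeff a (1 : perf_poly p r (quo J)) =
  quo_map J (mcoeff a (1 : perf_poly p r (quo I))).
Proof.
move=> IJ; rewrite !mcoeffU; case: (_ == _); first by rewrite quo_map1.
by rewrite quo_map0.
Qed.

Definition series1 : A := @Series p r R (fun=> 1) series1_subproof.

Lemma seriesB_subproof (f g : A) (I J : open_ideal R) (a : expo p r) :
  (I : set R) `<=` J ->
  mcoeff a (f J - g J) = quo_map J (mcoeff a (f I - g I)).
Proof.
by move=> IJ; rewrite !mcoeffB (proj_compat _ _ IJ) (proj_compat _ _ IJ) quo_mapB.
Qed.

Lemma seriesD_subproof (f g : A) (I J : open_ideal R) (a : expo p r) :
  (I : set R) `<=` J ->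
  mcoeff a (f J + g J) = quo_map J (mcoeff a (f I + g I)).
Proof.
by move=> IJ; rewrite !mcoeffD (proj_compat _ _ IJ) (proj_compat _ _ IJ) quo_mapD.
Qed.

Lemma seriesN_subproof (f : A) (I J : open_ideal R) (a : expo p r) :
  (I : set R) `<=` J ->
  mcoeff a (- f J) = quo_map J (mcoeff a (- f I)).
Proof.
move=> IJ; rewrite !mcoeffN (proj_compat _ _ IJ) -[LHS]sub0r -(quo_map0 IJ).
by rewrite -quo_mapB // sub0r.
Qed.

Lemma seriesM_subproof (f g : A) (I J : open_ideal R) (a : expo p r) :
  (I : set R) `<=` J ->
  mcoeff a (f J * g J) = quo_map J (mcoeff a (f I * g I)).
Proof.
move=> IJ; apply: mcoeff_map_mul; first exact: quo_mapD.
- exact: quo_map0.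
- exact: quo_mapM.
- by move=> b; apply: proj_compat.
- by move=> b; apply: proj_compat.
Qed.

Definition seriesD (f g : A) : A :=
  @Series p r R (fun I => f I + g I) (seriesD_subproof f g).
Definition seriesN (f : A) : A :=
  @Series p r R (fun I => - f I) (seriesN_subproof f).
Definition seriesM (f g : A) : A :=
  @Series p r R (fun I => f I * g I) (seriesM_subproof f g).

Lemma seriesDA : associative seriesD.
Proof. by move=> f g h; apply: seriesP => I /=; rewrite addrA. Qed.
Lemma seriesDC : commutative seriesD.
Proof. by move=> f g; apply: seriesP => I /=; rewrite addrC. Qed.
Lemma series0D : left_id series0 seriesD.
Proof. by move=> f; apply: seriesP => I /=; rewrite add0r. Qed.
Lemma seriesND : left_inverse series0 seriesN seriesD.
Proof. by move=> f; apply: seriesP => I /=; rewrite addNr. Qed.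

HB.instance Definition _ :=
  GRing.isZmodule.Build A seriesDA seriesDC series0D seriesND.

Lemma seriesMA : associative seriesM.
Proof. by move=> f g h; apply: seriesP => I /=; rewrite mulrA. Qed.
Lemma seriesMC : commutative seriesM.
Proof. by move=> f g; apply: seriesP => I /=; rewrite mulrC. Qed.
Lemma series1M : left_id series1 seriesM.
Proof. by move=> f; apply: seriesP => I /=; rewrite mul1r. Qed.
Lemma seriesMDl : left_distributive seriesM +%R.
Proof. by move=> f g h; apply: seriesP => I /=; rewrite mulrDl. Qed.

HB.instance Definition _ :=
  GRing.Zmodule_isComPzRing.Build A seriesMA seriesMC series1M seriesMDl.

(* The inverse limit topology: the kernels of the projections form a
   fundamental system of neighborhoods of 0. *)
Definition series_nbhs (f : A) : set_system A :=
  filter_from [set: open_ideal R] (fun I => [set g : A | g I = f I]).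

HB.instance Definition _ := hasNbhs.Build A series_nbhs.

Lemma series_nbhs_filter (f : A) : ProperFilter (nbhs f).
Proof.
apply: filter_from_proper; last by move=> I _; exists f.
apply: filter_from_filter; first by exists (open_idealT R).
move=> I J _ _; exists (open_idealI I J) => // g /= gf.
have coefE (K : open_ideal R) : (open_idealI I J : set R) `<=` K -> g K = f K.
  by move=> IJK; apply/malgP => a; rewrite !(proj_compat _ _ IJK) gf.
by split; apply: coefE => x [].
Qed.

Lemma series_nbhs_singleton (f : A) (W : set A) : nbhs f W -> W f.
Proof. by case=> I _; apply. Qed.

Lemma series_nbhs_nbhs (f : A) (W : set A) : nbhs f W -> nbhs f (nbhs^~ W).
Proof. by case=> I _ IW; exists I => // g /= gf; exists I => // h /= hg; apply: IW; rewrite /= hg. Qed.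

HB.instance Definition _ := Nbhs_isNbhsTopological.Build A
  series_nbhs_filter series_nbhs_singleton series_nbhs_nbhs.

Lemma series_continuous2 (op : A -> A -> A) :
  (forall (I : open_ideal R) (f f' g g' : A),
     f I = f' I -> g I = g' I -> op f g I = op f' g' I) ->
  continuous (fun x : A * A => op x.1 x.2).
Proof.
move=> opP [f g] W [I _ IW].
exists ([set h : A | h I = f I], [set h : A | h I = g I]).
  by split; exists I.
by move=> [f' g'] [/= ff' gg']; apply: IW; apply: opP.
Qed.

Lemma series_sub_continuous : continuous (fun x : A * A => x.1 - x.2).
Proof. by apply: (@series_continuous2 (fun f g => f - g)) => I f f' g g' /= -> ->. Qed.

Lemma series_mul_continuous : continuous (fun x : A * A => x.1 * x.2).
Proof. by apply: (@series_continuous2 (fun f g => f * g)) => I f f' g g' /= -> ->. Qed.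

HB.instance Definition _ := PreTopologicalNmodule_isTopologicalZmodule.Build A
  series_sub_continuous.
HB.instance Definition _ := hasContinuousMul.Build A series_mul_continuous.

End SeriesRing.

(* When R is admissible, the elements of [series p r R] are the formal series
   with coefficients in R tending to 0, and the topology is the one given by
   the sets of series with all coefficients in a neighborhood V of 0. *)
Section FormalSeries.
Variables (p r : nat) (R : topComRingType).
Local Notation A := (series p r R).

Definition null_family (c : expo p r -> R) : Prop :=
  forall V : set R, nbhs 0 V -> finite_set [set a | ~ V (c a)].

Definition has_coefs (f : A) (c : expo p r -> R) : Prop :=
  forall (I : open_ideal R) a, mcoeff a (f I) = toquo I (c a).

Lemma nbhs0_open_ideal (I : open_ideal R) : nbhs (0 : R) (I : set R).
Proof.
by apply: open_nbhs_nbhs; split; [exact: open_idealP | case: (idealP I)].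
Qed.

Lemma toquo_eq0 (I : ideal R) (x : R) : toquo I x = 0 <-> ideal_set I x.
Proof. by rewrite -(raddf0 (toquo I)) toquo_eq subr0. Qed.

Lemma null_family_series (c : expo p r -> R) :
  null_family c -> exists! f : A, has_coefs f c.
Proof.
move=> c0.
pose F (I : open_ideal R) : perf_poly p r (quo I) :=
  [malg a in fset_set [set a | ~ (I : set R) (c a)] => toquo I (c a)].
have FE I a : mcoeff a (F I) = toquo I (c a).
  rewrite mcoeffE in_fset_set; last exact/c0/nbhs0_open_ideal.
  case: ifPn => // /negP aI; apply/esym/toquo_eq0; apply: contrapT => Ica.
  by apply: aI; rewrite in_setE.
have FC (I J : open_ideal R) a : (I : set R) `<=` J ->
    mcoeff a (F J) = quo_map J (mcoeff a (F I)).
  by move=> IJ; rewrite !FE quo_mapE.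
exists (Series FC); split=> // g gc; apply: seriesP => I.
by apply/malgP => a; rewrite gc FE.
Qed.

Lemma nbhs_addl (x : R) (V : set R) : nbhs x V -> nbhs 0 [set z | V (x + z)].
Proof.
move=> xV; have := @add_continuous R (x, 0).
rewrite /continuous_at /= addr0 => /(_ _ xV) [[B1 B2] [/= xB1 B20] BV].
apply: filterS B20 => z B2z; apply: (BV (x, z)); split=> //=.
exact: nbhs_singleton.
Qed.

Lemma nbhs_subr (x : R) (V : set R) : nbhs 0 V -> nbhs x [set y | V (y - x)].
Proof.
move=> V0; have := @sub_continuous R (x, x).
rewrite /continuous_at /= subrr => /(_ _ V0) [[B1 B2] [/= xB1 xB2] BV].
apply: filterS xB1 => y B1y; apply: (BV (y, x)); split=> //=.
exact: nbhs_singleton.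
Qed.

Hypothesis hR : admissible R.

Lemma nbhs0_has_open_ideal (V : set R) :
  nbhs 0 V -> exists I : open_ideal R, (I : set R) `<=` V.
Proof.
move=> V0; have [[linR _] _ _] := hR.
by have [I [idI oI IV]] := linR _ V0; exists (@OpenIdeal R (Ideal idI) oI).
Qed.

Lemma open_ideal_separated (x y : R) :
  (forall I : open_ideal R, toquo I x = toquo I y) -> x = y.
Proof.
have [_ hsR _] := hR; move=> xy; apply: hsR => B C xB yC.
exists y; split; last exact: nbhs_singleton.
have [I IB] := nbhs0_has_open_ideal (nbhs_addl xB).
have /IB /= := (toquo_eq I y x).1 (esym (xy I)).
by rewrite addrC subrK.
Qed.

Lemma open_ideal_complete (u : forall I : open_ideal R, quo I) :
  (forall I J : open_ideal R, (I : set R) `<=` J -> u J = quo_map J (u I)) ->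
  exists x : R, forall I, u I = toquo I x.
Proof.
move=> uC; have [_ _ cR] := hR.
pose F := filter_from [set: open_ideal R]
  (fun I => [set x : R | toquo I x = u I]).
have uF (I J : open_ideal R) x : (I : set R) `<=` J ->
    toquo I x = u I -> toquo J x = u J.
  by move=> IJ xI; rewrite (uC _ _ IJ) -xI quo_mapE.
have FF : ProperFilter F.
  apply: filter_from_proper; last first.
    by move=> I _; exists (repr (u I)); rewrite /= toquo_repr.
  apply: filter_from_filter; first by exists (open_idealT R).
  move=> I J _ _; exists (open_idealI I J) => // x xu.
  by split; apply: uF xu => y [].
have Fc : cauchy_filter F.
  move=> V /nbhs0_has_open_ideal[I IV].
  exists ([set x : R | toquo I x = u I], [set x : R | toquo I x = u I]).
    by split; exists I.
  by move=> [x y] [/= xI yI]; apply: IV; apply/toquo_eq; rewrite xI yI.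
have [l Fl] := cR F FF Fc; exists l => I.
have [J _ JI] := Fl _ (nbhs_subr l (nbhs0_open_ideal I)).
pose x : R := repr (u (open_idealI I J)).
have xIJ : toquo (open_idealI I J) x = u (open_idealI I J) by rewrite toquo_repr.
have xI : toquo I x = u I by apply: uF xIJ => y [].
have xJ : toquo J x = u J by apply: uF xIJ => y [].
by rewrite -xI; apply/toquo_eq/JI.
Qed.

Lemma has_coefs_null (f : A) (c : expo p r -> R) :
  has_coefs f c -> null_family c.
Proof.
move=> fc V /nbhs0_has_open_ideal[I IV].
apply: (sub_finite_set _ (finite_fset (msupp (f I)))) => a /= Vca.
rewrite -mcoeff_neq0 fc; apply/eqP => /toquo_eq0 /IV.
exact: Vca.
Qed.

Lemma series_has_coefs (f : A) :
  exists! c : expo p r -> R, null_family c /\ has_coefs f c.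
Proof.
have /choice[c cP] (a : expo p r) :
    exists x : R, forall I : open_ideal R, mcoeff a (f I) = toquo I x.
  by apply: open_ideal_complete => I J; apply: proj_compat.
have fc : has_coefs f c by move=> I a; apply: cP.
exists c; split=> [|d [_ fd]]; first by split=> //; apply: has_coefs_null fc.
by apply: funext => a; apply: open_ideal_separated => I; rewrite -fc fd.
Qed.

Lemma series_nbhs0 (W : set A) :
  nbhs (0 : A) W <->
  exists2 V : set R, nbhs 0 V &
    [set f : A | exists2 c, has_coefs f c & forall a, V (c a)] `<=` W.
Proof.
split=> [[I _ IW]|[V /nbhs0_has_open_ideal[I IV] VW]].
  exists (I : set R); first exact: nbhs0_open_ideal.
  move=> f [c fc cI]; apply: IW; apply/malgP => a.
  by rewrite fc mcoeff0; apply/toquo_eq0.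
exists I => // f /= fI; apply: VW.
have [c [[_ fc] _]] := series_has_coefs f.
exists c => // a; apply: IV; apply/toquo_eq0.
by rewrite -fc fI mcoeff0.
Qed.

End FormalSeries.

(* Main.v *)
Require Import Defs.
From mathcomp Require Import all_boot all_algebra all_classical topology.
From mathcomp Require Import monalg.

(** If [J0] is an ideal of definition of [R], then the kernel [J] of the
    projection of the inverse limit to level [J0] is an ideal of definition:
    coefficientwise [J] maps to the image of [J0] at every level [I], so [J^n]
    maps to the image of [J0^n], which vanishes as soon as [J0^n] lies in [I].
    Separatedness and completeness hold because an inverse limit of discrete
    rings is separated and complete. *)

Set Implicit Arguments.
Unset Strict Implicit.
Unset Printing Implicit Defensive.

Import GRing.Theory.

Local Open Scope classical_set_scope.
Local Open Scope ring_scope.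

Section IdealPowers.
Variable R : comPzRingType.
Implicit Types (J : set R) (n : nat).

Lemma ideal_exp_is_ideal J n : is_ideal (ideal_exp J n).
Proof.
split=> [I JI|x y Jx Jy I JI|b x Jx I JI].
- by have [[I0 _ _] _] := JI.
- by have [[_ ID _] _] := JI; exact: ID (Jx I JI) (Jy I JI).
- by have [[_ _ IM] _] := JI; exact: IM (Jx I JI).
Qed.

(** The only generator is the empty product 1, so the zeroth power is the whole ring. *)
Lemma ideal_exp0 J x : ideal_exp J 0 x.
Proof.
have [_ _ JM] := ideal_exp_is_ideal J 0; rewrite -[x]mulr1; apply: JM.
apply: sub_gen_smallest; exists (fun=> 0); split; first by case.
by rewrite big_ord0.
Qed.

Lemma ideal_expS J n x y :
  J x -> ideal_exp J n y -> ideal_exp J n.+1 (x * y).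
Proof.
move=> Jx Jy; have [J0 JD JM] := ideal_exp_is_ideal J n.+1.
(* The [z] with [x * z] in the next power form an ideal, so by minimality only the generators of
   [ideal_exp J n] need checking. *)
apply: (Jy [set z | ideal_exp J n.+1 (x * z)]); split.
  split=> [|z t|b z] /=; first by rewrite mulr0.
  - by rewrite mulrDr; apply: JD.
  - by rewrite mulrCA; apply: JM.
move=> _ [u [Ju ->]]; apply: sub_gen_smallest.
exists (fun i => if unlift ord0 i is Some j then u j else x); split.
  by move=> i; case: unliftP.
rewrite big_ord_recl unlift_none; congr (_ * _).
by apply: eq_bigr => i _; rewrite liftK.
Qed.

End IdealPowers.

Section Kernels.
Variables (p r : nat) (R : topComRingType).
Local Notation A := (series p r R).

Definition proj_kernel (I : open_ideal R) : set A := [set f | f I = 0].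

Lemma proj_kernel_ideal (I : open_ideal R) : is_ideal (proj_kernel I).
Proof.
split=> //= [f g fI gI|f g gI].
- by rewrite /proj_kernel /= fI gI addr0.
- by rewrite /proj_kernel /= gI mulr0.
Qed.

Lemma proj_kernel_open (I : open_ideal R) : open (proj_kernel I).
Proof.
by rewrite openE => f fI; exists I => // g /= gf; rewrite /proj_kernel /= gf.
Qed.

Lemma nbhs0_proj_kernel (V : set A) :
  nbhs 0 V -> exists I : open_ideal R, proj_kernel I `<=` V.
Proof. by case=> I _ IV; exists I. Qed.

(** A coefficient of [f * g] is a finite sum of products of coefficients, and the image of [L] in
    [quo I] is closed under sums. *)
Lemma mcoeff_mul_image (I J K L : ideal R) (f g : perf_poly p r (quo I)) :
    (forall x y, ideal_set J x -> ideal_set K y -> ideal_set L (x * y)) ->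
    (forall e, exists2 x, ideal_set J x & mcoeff e f = toquo I x) ->
    (forall e, exists2 x, ideal_set K x & mcoeff e g = toquo I x) ->
  forall e, exists2 x, ideal_set L x & mcoeff e (f * g) = toquo I x.
Proof.
move=> JKL fJ gK e; have [L0 LD _] := idealP L.
pose P (z : quo I) := exists2 x, ideal_set L x & z = toquo I x.
have P0 : P 0 by exists 0 => //; rewrite raddf0.
have PD y z : P y -> P z -> P (y + z).
  move=> [x Lx ->] [x' Lx' ->]; exists (x + x'); first exact: LD.
  by rewrite raddfD.
rewrite -/(P _) malg_mulE /malg_mul raddf_sum.
apply: (big_ind P) => // b _; rewrite raddf_sum.
apply: (big_ind P) => // c _; rewrite /= mcoeffU.
case: (_ == _); last by rewrite mulr0n.
have [x Jx ->] := fJ b; have [y Ky ->] := gK c.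
by exists (x * y); [apply: JKL | rewrite rmorphM mulr1n].
Qed.

Lemma proj_kernel_mcoeff (J I : open_ideal R) (f : A) :
    proj_kernel J f ->
  forall e, exists2 x, ideal_set J x & mcoeff e (f I) = toquo I x.
Proof.
(* [J] and [I] need not be comparable, so the lift is taken at the level of their intersection,
   which maps to both. *)
move=> fJ e; pose x := repr (mcoeff e (f (open_idealI J I))).
exists x; last by apply: proj_compat => y [].
apply/toquo_eq0; rewrite -[LHS]/(quo_map J _) -proj_compat; last by move=> y [].
by rewrite fJ mcoeff0.
Qed.

Lemma proj_prod_mcoeff (J I : open_ideal R) n (u : 'I_n -> A) :
    (forall i, proj_kernel J (u i)) ->
  forall e, exists2 x, ideal_exp J n x &
    mcoeff e ((\prod_i u i) I) = toquo I x.
Proof.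
elim: n u => [|n IHn] u uJ e.
  (* Any lift will do, the zeroth power being all of [R]. *)
  exists (repr (mcoeff e ((\prod_i u i) I))); first exact: ideal_exp0.
  by rewrite toquo_repr.
rewrite big_ord_recl.
apply: (@mcoeff_mul_image I J (Ideal (ideal_exp_is_ideal J n))
  (Ideal (ideal_exp_is_ideal J n.+1))) => [x y|e'|e'].
- exact: ideal_expS.
- exact: proj_kernel_mcoeff.
- by apply: IHn => i; apply: uJ.
Qed.

Lemma ideal_exp_proj_kernel (J I : open_ideal R) n :
  ideal_exp J n `<=` I -> ideal_exp (proj_kernel J) n `<=` proj_kernel I.
Proof.
move=> JI; apply: smallest_sub; first exact: proj_kernel_ideal.
move=> _ [u [uJ ->]]; apply/malgP => e; rewrite mcoeff0.
have [x /JI Ix ->] := proj_prod_mcoeff I uJ e.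
exact/toquo_eq0.
Qed.

Lemma proj_kernel_ideal_of_definition (J : open_ideal R) :
  ideal_of_definition (J : set R) -> ideal_of_definition (proj_kernel J).
Proof.
move=> [_ _ Jn]; split; [exact: proj_kernel_ideal|exact: proj_kernel_open|].
move=> V /nbhs0_proj_kernel[I IV].
have [n n0 JnI] := Jn _ (nbhs0_open_ideal I).
by exists n => //; apply: subset_trans IV; apply: ideal_exp_proj_kernel.
Qed.

Lemma series_linearly_topologized : linearly_topologized A.
Proof.
move=> V /nbhs0_proj_kernel[I IV]; exists (proj_kernel I).
by split=> //; [exact: proj_kernel_ideal | exact: proj_kernel_open].
Qed.

Lemma series_hausdorff : hausdorff_space A.
Proof.
move=> f g fg; apply: seriesP => I.
have nbhs_level (h : A) : nbhs h [set k : A | k I = h I] by exists I.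
by have [h [/= <- <-]] := fg _ _ (nbhs_level f) (nbhs_level g).
Qed.

Lemma series_complete : complete A.
Proof.
move=> F FF Fc.
have /choice[g Fg] (I : open_ideal R) :
    exists g : A, F [set h : A | h I = g I].
  (* The Cauchy condition for [proj_kernel I] makes the level [I] projection constant on a member of
     [F]. *)
  have [|[B C] [/= FB FC] BC] := Fc (proj_kernel I); first by exists I.
  have [g [_ Cg]] := filter_ex (filterI FB FC).
  exists g; apply: filterS FB => h Bh /=; apply/eqP; rewrite -subr_eq0.
  by apply/eqP; apply: (BC (h, g)).
have lC (I J : open_ideal R) e : (I : set R) `<=` J ->
    mcoeff e (g J J) = quo_map J (mcoeff e (g I I)).
  (* As [F] is proper, a single series [h] realizes both levels, so compatibility is inherited from
     [h]. *)
  move=> IJ; have [h [/= <- <-]] := filter_ex (filterI (Fg I) (Fg J)).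
  exact: proj_compat.
(* The limit is diagonal: its level [I] is that of the series [g I] chosen for [I]. *)
exists (Series lC) => V [I _ IV]; exact: filterS (Fg I).
Qed.

End Kernels.

Theorem lemma3p3 (p r : nat) (hp : (2 <= p)%N) (hr : (1 <= r)%N)
    (R : topComRingType) (hR : admissible R)
    (a : set R) (ha : ideal_of_definition a) :
  admissible (series p r R).
Proof.
split; [split | exact: series_hausdorff | exact: series_complete].
  exact: series_linearly_topologized.
have [aI aO _] := ha; pose J := @OpenIdeal R (Ideal aI) aO.
by exists (proj_kernel J); apply: proj_kernel_ideal_of_definition.
Qed.
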